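(* Let $P=\{p_1,\ldots,p_m\}$ be a finite poset, let $A_1,\ldots,A_m$ be non-empty subsets of $[n]$, and let $\mathfrak{A}$ be a poset ideal of $\mathrm{Hom}(P,A_1,\ldots,A_m)$. Then the simplicial complex $\Delta(\mathfrak{A})$ is either a simplicial ball or a simplicial sphere.
   Context: $n$ is a positive integer, $[n]=\{1,\ldots,n\}$; $p_i<p_j$ implies $i<j$. $\mathrm{Hom}(P,A_1,\ldots,A_m)$ is the set of maps $f:P\to[n]$ that are isotone ($p\le q$ implies $f(p)\le f(q)$) with $f(p_i)\in A_i$ for all $i$, partially ordered by $f\le g$ iff $f(p)\le g(p)$ for all $p$. A poset ideal of a poset $Q$ is a non-empty subset $I\subseteq Q$ such that $y\in I$, $x\in Q$, $x\le y$ imply $x\in I$. $\mathcal{L}(\mathfrak{A})$ is the monomial ideal generated by $U_f=\prod_{p\in P}X_{p,f(p)}$, $f\in\mathfrak{A}$. $\Delta(\mathfrak{A})$ is the Stanley–Reisner complex of the Alexander dual $\mathcal{L}(\mathfrak{A})^{\vee}$, regarded as a simplicial complex on the vertex set $V=\{(p_i,a)\mid 1\le i\le m,\ a\in A_i\}$ (with $(p_i,a)$ corresponding to $X_{p_i,a}$). Equivalently, its facets are the sets $V\setminus\Gamma f$, $f\in\mathfrak{A}$, where $\Gamma f=\{(p,f(p))\mid p\in P\}$. A simplicial complex is a simplicial sphere (resp. simplicial ball) if its geometric realization is homeomorphic to $S^d=\{v\in\mathbf{R}^{d+1}\mid |v|=1\}$ (resp. $B^d=\{v\in\mathbf{R}^d\mid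 |v|\le1\}$) for some $d$. The complex $\{\emptyset\}$ counts as the sphere $S^{-1}=\emptyset$. *)

(* Defs.v *)
From HB Require Import structures.
From mathcomp Require Import all_boot all_order all_algebra.
From mathcomp Require Import finmap.
From mathcomp Require Import -(notations) monalg.
From mathcomp Require Import all_classical all_reals all_analysis.
Import Order.TTheory GRing.Theory Num.Theory numFieldNormedType.Exports.

Set Implicit Arguments.
Unset Strict Implicit.
Unset Printing Implicit Defensive.

Local Open Scope classical_set_scope.
Local Open Scope ring_scope.

Definition poset_ideal (T : Type) (le : T -> T -> Prop) (Q I : set T) : Prop :=
  [/\ I !=set0, I `<=` Q & forall x y, I y -> Q x -> le x y -> I x].

(* The chain [n] = {1, ..., n} is represented by 'I_n = {0, ..., n-1}. *)
Definition poset_Hom (d : Order.disp_t) (P : finPOrderType d) (m n : nat)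
    (p : 'I_m -> P) (A : 'I_m -> {set 'I_n}) : set {ffun P -> 'I_n} :=
  [set f : {ffun P -> 'I_n} |
    (forall x y : P, (x <= y)%O -> (f x <= f y)%N) /\
    (forall i, f (p i) \in A i)].

Definition map_le (P : finType) (n : nat) (f g : {ffun P -> 'I_n}) : Prop :=
  forall x, (f x <= g x)%N.

(* Unlike [idealr_closed], this does not ask an ideal to be proper. *)
Definition is_ideal (S : comNzRingType) (I : set S) : Prop :=
  [/\ I 0, (forall x y, I x -> I y -> I (x + y)) &
      (forall a x, I x -> I (a * x))].

Definition ideal_generated (S : comNzRingType) (G : set S) : set S :=
  smallest (@is_ideal S) G.

(* k[X_v : v in T] *)
Definition polyring (k : fieldType) (T : finType) : comNzRingType :=
  malg (cmonom T) k.

Definition polyvar (k : fieldType) (T : finType) (v : T) : polyring k T :=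
  mkmalgU (ucm v) 1.

Definition sqfree_monomial (k : fieldType) (T : finType) (F : {set T}) :
    polyring k T :=
  \prod_(v in F) polyvar k v.

(* Not every element of T has to be a vertex of K.  The void complex, which has
   no face at all, is excluded; {emptyset} is not. *)
Definition simplicial_complex (T : finType) (K : set {set T}) : Prop :=
  K (finset.set0 : {set T}) /\
  forall F G : {set T}, F \subset G -> K G -> K F.

Definition facet (T : finType) (K : set {set T}) (F : {set T}) : Prop :=
  K F /\ forall G : {set T}, K G -> F \subset G -> G = F.

Definition SR_complex (k : fieldType) (T : finType) (I : set (polyring k T)) :
    set {set T} :=
  [set F : {set T} | ~ I (sqfree_monomial k F)].

Definition SR_ideal (k : fieldType) (T : finType) (K : set {set T}) :
    set (polyring k T) :=
  ideal_generated [set sqfree_monomial k F | F in ~` K].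

Definition dual_complex (T : finType) (K : set {set T}) : set {set T} :=
  [set F : {set T} | ~ K (finset.setC F)].

Fact mem_sqfree_ideal (k : fieldType) (T : finType) (K : set {set T})
    (G : {set T}) :
  ideal_generated [set sqfree_monomial k F | F in K] (sqfree_monomial k G) <->
  exists2 F : {set T}, K F & F \subset G.
Proof.
pose mon (F : {set T}) : cmonom T := \big[mmul/mone]_(v in F) ucm v.
have monP F v : mon F v = (v \in F) :> nat.
  rewrite /mon (big_morph (fun m : cmonom T => m v) (cmM v) (cm1 v)).
  rewrite (eq_bigr (fun w => (w == v) : nat)); last by move=> w _; rewrite cmU.
  case: (boolP (v \in F)) => vF.
    rewrite (bigD1 v) //= eqxx big1 ?addn0 // => w /andP[_ wv].
    by rewrite (negbTE wv).
  by rewrite big1 // => w wF; case: eqP => // wv; rewrite wv (negbTE vF) in wF.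
have sqE F : sqfree_monomial k F = mkmalgU (mon F) 1 :> malg (cmonom T) k.
  rewrite /sqfree_monomial /mon; symmetry.
  apply: (big_morph (fun m => mkmalgU m 1 : polyring k T)) => // m1 m2.
  by rewrite [RHS]fgmulUU mulr1.
split.
  pose J : set (polyring k T) := [set x : polyring k T |
    forall m, mcoeff m x != 0 ->
    exists2 F : {set T}, K F & forall v, v \in F -> m v != 0%N].
  have Jideal : is_ideal J.
    split.
    - by move=> m; rewrite mcoeff0 eqxx.
    - move=> x y Jx Jy m; rewrite mcoeffD => xy0.
      case: (eqVneq (mcoeff m x) 0) => [x0|]; last exact: Jx.
      by apply: Jy; move: xy0; rewrite x0 add0r.
    - move=> a x Jx m; rewrite mcoeff_neq0 => /msuppM_le[m1 [m2 [_ m2x ->]]].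
      have [|F KF mF] := Jx m2; first by rewrite mcoeff_neq0.
      by exists F => // v /mF; rewrite cmM addn_eq0 negb_and => ->; rewrite orbT.
  have GJ : [set sqfree_monomial k F | F in K] `<=` J.
    move=> _ [F KF <-] m; rewrite sqE mcoeffU.
    case: (eqVneq (mon F) m) => [<- _|_]; last by rewrite eqxx.
    by exists F => // v vF; rewrite monP vF.
  move=> /(_ J (conj Jideal GJ) (mon G)); rewrite sqE mcoeffU eqxx oner_eq0.
  case=> // F KF mF; exists F => //.
  by apply/fintype.subsetP => v /mF; rewrite monP; case: (v \in G).
move=> [F KF FG] I [[_ _ Imul] GI].
rewrite /sqfree_monomial (big_setID F) /= (finset.setIidPr FG) mulrC.
by apply: Imul; apply: GI; exists F.
Qed.

Definition alexander_dual (k : fieldType) (T : finType)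
    (I : set (polyring k T)) : set (polyring k T) :=
  SR_ideal (dual_complex (SR_complex I)).

Definition U_monomial (k : fieldType) (P : finType) (n : nat)
    (f : {ffun P -> 'I_n}) : polyring k (P * 'I_n)%type :=
  \prod_(x : P) polyvar k (x, f x).

Definition L_ideal (k : fieldType) (P : finType) (n : nat)
    (AA : set {ffun P -> 'I_n}) : set (polyring k (P * 'I_n)%type) :=
  ideal_generated [set U_monomial k f | f in AA].

Definition vertex_set (P : finType) (m n : nat)
    (p : 'I_m -> P) (A : 'I_m -> {set 'I_n}) : {set P * 'I_n} :=
  finset [pred v : P * 'I_n |
    [exists i, [exists a in A i, v == (p i, a)]]].

(* The monomial ideals live in the ring with all the variables X_{x,a}, x in P
   and a in [n]; only the faces inside the vertex set V are kept. *)
Definition Delta (k : fieldType) (P : finType) (m n : nat)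
    (p : 'I_m -> P) (A : 'I_m -> {set 'I_n}) (AA : set {ffun P -> 'I_n}) :
    set {set P * 'I_n} :=
  [set F : {set P * 'I_n} |
    SR_complex (alexander_dual (@L_ideal k P n AA)) F /\ F \subset vertex_set p A].

Definition graph_set (P : finType) (n : nat) (f : {ffun P -> 'I_n}) :
    {set P * 'I_n} :=
  finset [pred v : P * 'I_n | v.2 == f v.1].

Fact U_monomialE (k : fieldType) (P : finType) (n : nat)
    (f : {ffun P -> 'I_n}) :
  U_monomial k f = sqfree_monomial k (graph_set f).
Proof.
rewrite /sqfree_monomial (reindex_onto (fun x => (x, f x)) fst) /=.
  by apply: eq_bigl => x; rewrite inE /= !eqxx.
by move=> [x a]; rewrite inE /= => /eqP ->.
Qed.

Fact DeltaP (k : fieldType) (P : finType) (m n : nat) (p : 'I_m -> P)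
    (A : 'I_m -> {set 'I_n}) (AA : set {ffun P -> 'I_n}) (F : {set P * 'I_n}) :
  Delta k p A AA F <->
  F \subset vertex_set p A /\
  exists2 f, AA f & graph_set f \subset finset.setC F.
Proof.
have LP (G : {set P * 'I_n}) : @L_ideal k P n AA (sqfree_monomial k G) <->
    exists2 f, AA f & graph_set f \subset G.
  have -> : @L_ideal k P n AA =
      ideal_generated [set sqfree_monomial k H | H in @graph_set P n @` AA].
    rewrite /L_ideal image_comp; congr ideal_generated.
    by apply: eq_imagel => f _; exact: U_monomialE.
  rewrite mem_sqfree_ideal; split=> [[_ [f AAf <-] fG]|[f AAf fG]].
    by exists f.
  by exists (graph_set f) => //; exists f.
have KP : SR_complex (alexander_dual (@L_ideal k P n AA)) F <->
    exists2 f, AA f & graph_set f \subset finset.setC F.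
  rewrite /SR_complex /= /alexander_dual /SR_ideal mem_sqfree_ideal; split.
    move=> nF; apply/LP; apply: contrapT => nL; apply: nF; exists F => //.
  move=> [f AAf fF] [G nKG GF]; apply: nKG => nL; apply: nL; apply/LP.
  by exists f => //; apply: fintype.subset_trans fF _; rewrite finset.setCS.
by split=> [[/KP ? ?]|[? /KP]].
Qed.

Fact facet_Delta (k : fieldType) (d : Order.disp_t) (P : finPOrderType d)
    (m n : nat) (p : 'I_m -> P) (A : 'I_m -> {set 'I_n})
    (AA : set {ffun P -> 'I_n}) (F : {set P * 'I_n}) :
  bijective p -> AA `<=` poset_Hom p A ->
  facet (Delta k p A AA) F <->
  exists2 f, AA f & F = finset.setD (vertex_set p A) (graph_set f).
Proof.
move=> [q pK qK] AAH.
have fV f : AA f -> graph_set f \subset vertex_set p A.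
  move=> /AAH[_ fA]; apply/fintype.subsetP => -[x a]; rewrite !inE /= => /eqP ->.
  apply/existsP; exists (q x); apply/existsP; exists (f x).
  by rewrite qK eqxx -[X in f X]qK fA.
have face f : AA f ->
    Delta k p A AA (finset.setD (vertex_set p A) (graph_set f)).
  move=> AAf; apply/DeltaP; split; first exact: finset.subsetDl.
  exists f => //; apply/fintype.subsetP => v vf.
  by rewrite finset.in_setC finset.in_setD vf.
split=> [[/DeltaP[FV [f AAf fF]] Fmax]|[f AAf ->]].
  exists f => //; apply/esym/Fmax; first exact: face.
  by rewrite finset.subsetD FV disjoint_sym finset.disjoints_subset.
split=> [|G /DeltaP[GV [g AAg gG]] fG]; first exact: face.
suff fg : f = g.
  apply/eqP; rewrite finset.eqEsubset fG andbT finset.subsetD GV.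
  by rewrite disjoint_sym finset.disjoints_subset fg.
apply/ffunP => x; apply/eqP; case: (boolP (f x == g x)) => // fgx.
have xg : (x, g x) \in graph_set g by rewrite inE /=.
have xV : (x, g x) \in vertex_set p A by apply: (fintype.subsetP (fV g AAg)).
have xG : (x, g x) \in G.
  apply: (fintype.subsetP fG); rewrite finset.in_setD xV andbT inE /= eq_sym.
  exact: fgx.
by have := fintype.subsetP gG _ xg; rewrite finset.in_setC xG.
Qed.

(* Barycentric coordinates in R^T, with the product topology.  The elements of
   T that are not vertices of K only contribute zero coordinates. *)
Definition geometric_realization (R : realType) (T : finType)
    (K : set {set T}) : set {ptws T -> R} :=
  [set x : {ptws T -> R} |
    [/\ (forall v, 0 <= x v), \sum_(v : T) x v = 1 &
        K (finset [pred v | x v != 0])]].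

Definition homeomorphic (X Y : topologicalType) : Prop :=
  exists (f : X -> Y) (g : Y -> X),
    [/\ continuous f, continuous g, cancel f g & cancel g f].

(* The norm of the library on 'rV[R]_d is the sup norm, which defines the same
   topology. *)
Definition euclidean_norm (R : realType) (d : nat) (x : 'rV[R]_d) : R :=
  Num.sqrt (\sum_(i < d) x ord0 i ^+ 2).

Definition unit_sphere (R : realType) (d : nat) : set 'rV[R]_d :=
  [set x : 'rV[R]_d | euclidean_norm x = 1].

Definition unit_ball (R : realType) (d : nat) : set 'rV[R]_d :=
  [set x : 'rV[R]_d | euclidean_norm x <= 1].

(* The sphere in R^d is S^(d-1); d = 0 is the empty sphere S^(-1), which is the
   realization of {emptyset}. *)
Definition simplicial_sphere (R : realType) (T : finType) (K : set {set T}) :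
    Prop :=
  simplicial_complex K /\
  exists d : nat,
    homeomorphic (set_type (@geometric_realization R T K))
                 (set_type (@unit_sphere R d)).

Definition simplicial_ball (R : realType) (T : finType) (K : set {set T}) :
    Prop :=
  simplicial_complex K /\
  exists d : nat,
    homeomorphic (set_type (@geometric_realization R T K))
                 (set_type (@unit_ball R d)).

(* Main.v *)
Require Import Defs.
From HB Require Import structures.
From mathcomp Require Import all_boot all_order all_algebra.
From mathcomp Require Import all_classical all_reals all_analysis.
From mathcomp Require Import lra.
Import Order.TTheory GRing.Theory Num.Theory numFieldNormedType.Exports.

(** The cone over the realization consists of the non-negative functions on
    the vertices [(x, a)] that vanish on the graph of some [f] in the ideal.
    Such a function is determined by its class modulo constants on the rows
    [z (x, _)], as the representative whose row minima are [0]
    ([fan_coneP]). For an arbitrary representative [z] the condition says that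
    some [f] in the ideal attains all row minima of [z]. This describes the
    cone as a region [fan] in a linear space. The maps below are continuous
    and positively homogeneous, and such maps between cones induce
    homeomorphisms between the slices that gauges cut out of them
    ([slice_homeomorphic]).

    Let [f] be a maximal element of the ideal. The vertices off its graph are
    low, if [f] can be lowered to them while staying isotone, or high. Two
    facts govern the ideal near [f]: replacing any set of values of [f] by low
    ones stays in the ideal, with no condition linking the replacements
    ([low_choice]), and every other element of the ideal uses some low vertex
    ([low_exists]). Let [mu] and [nu] be the minima over the low and the high
    vertices of [z (x, a) - z (x, f x)]. The first fact shows that the region
    of the ideal contains every [z] with [nu >= 0]; with the second, it
    follows that removing [f] from the ideal cuts the region down to
    [mu <= 0]. What is removed is thus given by [mu > 0], [nu >= 0]. Raising
    the low coordinates while lowering the high ones moves along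
    [mu + nu = c] and stretches the rest over the removed part
    ([fan_cone_step]). This is a step of a shelling, made into an explicit
    piecewise linear homeomorphism.

    If every element of the ideal has a high vertex, all elements but one can
    be removed in this way, and the cone of a single map is an orthant of
    positive dimension. An orthant is equivalent to a half-space
    ([orthant_halfspace]), whose slice is a ball ([halfspace_ball]). If some
    [f] has no high vertex, then the region is the whole space
    ([fan_cone_full]), and the slice is a sphere ([subspace_sphere]). *)

Set Implicit Arguments.
Unset Strict Implicit.
Unset Printing Implicit Defensive.

Local Open Scope classical_set_scope.
Local Open Scope ring_scope.

(** * Continuity and homeomorphisms of subsets *)

Lemma ptws_continuous (R : realType) (T : finType) (X : topologicalType)
    (f : X -> {ptws T -> R}) (x : X) :
  (forall v, {for x, continuous (fun y => f y v)}) -> {for x, continuous f}.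
Proof.
move=> cf; apply/cvg_sup => v U [/= B [[C oC <-] Cfx] BU].
have Cfx' : nbhs (f x v) C by exact: open_nbhs_nbhs.
apply: (@filterS _ (nbhs x) _ (fun y => C (f y v))) (cf v C Cfx') => y Cy.
exact: BU.
Qed.

Lemma ptws_coord_continuous (R : realType) (T : finType) (v : T) :
  continuous (fun z : {ptws T -> R} => z v).
Proof. exact: (@proj_continuous T (fun=> R) v). Qed.

Lemma rV_continuous (R : realType) (d : nat) (X : topologicalType)
    (f : X -> 'rV[R]_d) (x : X) :
  (forall i, {for x, continuous (fun y => f y ord0 i)}) ->
  {for x, continuous f}.
Proof.
move=> cf U [P fP PU].
have : \forall y \near x, forall i, P ord0 i (f y ord0 i).
  by apply: filter_forall => i; apply: (cf i); apply: fP.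
apply: filterS => y Py; apply: PU => i j; rewrite ord1; exact: Py.
Qed.

Lemma sum_continuous (R : realType) (X : topologicalType) (I : finType)
    (Q : pred I) (F : I -> X -> R) :
  (forall i, Q i -> continuous (F i)) ->
  continuous (fun x => \sum_(i | Q i) F i x).
Proof.
move=> cF; apply: continuous_big => [|i]; last exact: cF.
by move=> x; apply: (@cvgD _ R^o); [exact: cvg_fst|exact: cvg_snd].
Qed.

Lemma homeomorphic_subsets (X Y : topologicalType) (A : set X) (B : set Y)
    (f : X -> Y) (g : Y -> X) :
  (forall x, A x -> {for x, continuous f}) ->
  (forall y, B y -> {for y, continuous g}) ->
  (forall x, A x -> B (f x)) -> (forall y, B y -> A (g y)) ->
  (forall x, A x -> g (f x) = x) -> (forall y, B y -> f (g y) = y) ->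
  homeomorphic (set_type A) (set_type B).
Proof.
move=> cf cg fAB gBA gf fg.
have inA (x : set_type A) : A (set_val x) by exact: set_valP.
have inB (y : set_type B) : B (set_val y) by exact: set_valP.
exists (fun x => SigSub (mem_set (fAB _ (inA x)))).
exists (fun y => SigSub (mem_set (gBA _ (inB y)))).
split.
- apply: continuous_comp_initial => x.
  apply: (@continuous_comp _ _ _ set_val f); last exact: cf.
  exact: initial_continuous.
- apply: continuous_comp_initial => y.
  apply: (@continuous_comp _ _ _ set_val g); last exact: cg.
  exact: initial_continuous.
- by move=> x; apply: val_inj; rewrite /= gf.
- by move=> x; apply: val_inj; rewrite /= fg.
Qed.

Lemma homeomorphic_trans (X Y Z : topologicalType) :
  homeomorphic X Y -> homeomorphic Y Z -> homeomorphic X Z.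
Proof.
move=> [f [g [cf cg fK gK]]] [f' [g' [cf' cg' fK' gK']]].
exists (f' \o f), (g \o g'); split.
- by move=> x; apply: (@continuous_comp _ _ _ f f'); [exact: cf|exact: cf'].
- by move=> x; apply: (@continuous_comp _ _ _ g' g); [exact: cg'|exact: cg].
- exact: can_comp.
- exact: can_comp.
Qed.

(** * Minima over a finite set *)

(** The sum of absolute values bounds every [u v], so that on a non-empty [S]
    the initial value of the iterated minimum is irrelevant. *)
Definition minon (R : realType) (T : finType) (S : {set T}) (u : T -> R) : R :=
  \big[Num.min/(\sum_v `|u v|)]_(v in S) u v.

Section Minon.
Variables (R : realType) (T : finType).
Implicit Types (S : {set T}) (u w : T -> R).

Lemma minon_le S u v : v \in S -> minon S u <= u v.
Proof. by move=> vS; rewrite /minon; apply: bigmin_le_cond. Qed.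

Lemma minon_attained S u v0 : v0 \in S -> exists2 v, v \in S & minon S u = u v.
Proof.
move=> v0S; have [|v vS e] := @eq_bigmin _ R T (\sum_v `|u v|) v0 (mem S) u v0S.
  move=> i _; rewrite (bigD1 i) //=; apply: le_trans (ler_norm _) _.
  by rewrite lerDl sumr_ge0.
by exists v.
Qed.

Lemma minon_eqP S u v c :
  v \in S -> u v = c -> (forall x, x \in S -> c <= u x) -> minon S u = c.
Proof.
move=> vS uv ule; apply/le_anti/andP; split.
  by rewrite -uv; exact: minon_le.
by have [x xS ->] := minon_attained u vS; exact: ule.
Qed.

Lemma minon_shift S u w c v0 : v0 \in S ->
  (forall v, v \in S -> w v = u v + c) -> minon S w = minon S u + c.
Proof.
move=> v0S uw; have [v vS e] := minon_attained u v0S.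
apply: (minon_eqP vS); first by rewrite uw // e.
by move=> x xS; rewrite uw // lerD2r minon_le.
Qed.

Lemma eq_minon S u w v0 : v0 \in S ->
  {in S, u =1 w} -> minon S u = minon S w.
Proof.
move=> v0S uw; have [v vS e] := minon_attained w v0S.
by apply: (minon_eqP vS); rewrite ?e ?uw // => x xS; rewrite uw // -e minon_le.
Qed.

Lemma minonZ S u c : 0 < c -> minon S (fun v => c * u v) = c * minon S u.
Proof.
move=> c0; rewrite /minon.
have -> : \sum_v `|c * u v| = c * \sum_v `|u v|.
  by rewrite mulr_sumr; apply: eq_bigr => v _; rewrite normrM gtr0_norm.
elim/big_ind2: _ => // x1 x2 y1 y2 -> ->.
by rewrite -minr_pMr // ltW.
Qed.

Lemma minon_continuous (X : topologicalType) S (F : X -> T -> R) :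
  (forall v, continuous (F ^~ v)) -> continuous (fun x => minon S (F x)).
Proof.
move=> cF.
have minC (G H : X -> R) : continuous G -> continuous H ->
    continuous (fun x => Num.min (G x) (H x)).
  by move=> cG cH x; apply: continuous_min; [exact: cG|exact: cH].
pose M x : R := \sum_v `|F x v|.
have cM : continuous M.
  by apply: sum_continuous => v _ x; apply: cvg_norm; apply: cF.
change (continuous (fun x => \big[Num.min/M x]_(v in S) F x v)).
move: M cM => M cM.
elim: (index_enum T) => [|v r IH].
  by under eq_fun do rewrite big_nil; exact: cM.
under eq_fun do rewrite big_cons.
by case: (v \in S) => //; apply: minC.
Qed.

End Minon.

(** * Cones and their slices *)

Section Cones.
Variables (R : realType) (T : finType).
Local Notation E := {ptws T -> R}.
Implicit Types (C : set E) (z : E) (B : {set T}).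

Definition scalep (c : R) z : E := fun v => c * z v.

Definition cone C : Prop := forall c z, 0 < c -> C z -> C (scalep c z).

Definition homog_fun (lam : E -> R) : Prop :=
  forall c z, 0 < c -> lam (scalep c z) = c * lam z.

Definition homog_map (phi : E -> E) : Prop :=
  forall c z, 0 < c -> phi (scalep c z) = scalep c (phi z).

(** Both maps are continuous on the whole ambient space; they are required to
    be inverse to each other on the cones only. *)
Definition cone_equiv C C' : Prop :=
  exists phi psi : E -> E,
    [/\ continuous phi, continuous psi, homog_map phi & homog_map psi] /\
    [/\ forall z, C z -> C' (phi z), forall z, C' z -> C (psi z),
        forall z, C z -> psi (phi z) = z & forall z, C' z -> phi (psi z) = z].

(** The last clause is positivity away from [0]. *)
Definition gauge_on C (lam : E -> R) : Prop :=
  [/\ continuous lam, homog_fun lam &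
      forall z, C z -> lam z <= 0 -> z = (fun=> 0)].

Lemma cone_equiv_refl C : cone_equiv C C.
Proof. by exists id, id; split; split=> // z; exact: cvg_id. Qed.

Lemma cone_equiv_sym C C' : cone_equiv C C' -> cone_equiv C' C.
Proof. by move=> [f [g [[cf cg hf hg] [fC gC fK gK]]]]; exists g, f. Qed.

Lemma cone_equiv_trans C1 C2 C3 :
  cone_equiv C1 C2 -> cone_equiv C2 C3 -> cone_equiv C1 C3.
Proof.
move=> [f [g [[cf cg hf hg] [f12 g21 gf fg]]]].
move=> [f' [g' [[cf' cg' hf' hg'] [f23 g32 gf' fg']]]].
exists (f' \o f), (g \o g'); split; split=> /=.
- by move=> z; apply: continuous_comp; [exact: cf|exact: cf'].
- by move=> z; apply: continuous_comp; [exact: cg'|exact: cg].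
- by move=> c z c0 /=; rewrite hf // hf'.
- by move=> c z c0 /=; rewrite hg' // hg.
- by move=> z /f12 /f23.
- by move=> z /g32 /g21.
- by move=> z Cz; rewrite gf' ?gf //; exact: f12.
- by move=> z Cz; rewrite fg ?fg' //; exact: g32.
Qed.

Lemma homog_fun0 (lam : E -> R) : homog_fun lam -> lam (fun=> 0) = 0.
Proof.
move=> /(_ 2 (fun=> 0) (ltr0Sn _ _)).
have -> : scalep 2 (fun=> 0) = (fun=> 0).
  by apply/funext => v; rewrite /scalep mulr0.
by lra.
Qed.

Lemma homog_map0 (phi : E -> E) : homog_map phi -> phi (fun=> 0) = (fun=> 0).
Proof.
move=> hphi; apply/funext => v; apply: (@homog_fun0 (phi ^~ v)) => c z c0.
by rewrite hphi.
Qed.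

(** Follow the map between the cones by the radial projection to the slice.
    Homogeneity turns the correction factor of one direction into the inverse
    of that of the other. *)
Lemma slice_homeomorphic C C' (lam lam' : E -> R) :
  cone C -> cone C' -> cone_equiv C C' -> gauge_on C lam -> gauge_on C' lam' ->
  homeomorphic (set_type [set z | C z /\ lam z = 1])
               (set_type [set z | C' z /\ lam' z = 1]).
Proof.
(* Both directions need the same three facts, so one proof serves twice. *)
wlog suff half : C C' lam lam' / forall (phi psi : E -> E),
    cone C' -> continuous phi -> homog_map phi -> homog_map psi ->
    (forall z, C z -> C' (phi z)) -> (forall z, C z -> psi (phi z) = z) ->
    gauge_on C lam -> gauge_on C' lam' ->
    [/\ forall z, C z /\ lam z = 1 ->
          {for z, continuous (fun z : E => scalep (lam' (phi z))^-1 (phi z))},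
        forall z, C z /\ lam z = 1 ->
          C' (scalep (lam' (phi z))^-1 (phi z)) /\
          lam' (scalep (lam' (phi z))^-1 (phi z)) = 1 &
        forall z, C z /\ lam z = 1 ->
          scalep (lam (psi (scalep (lam' (phi z))^-1 (phi z))))^-1
            (psi (scalep (lam' (phi z))^-1 (phi z))) = z].
  move=> KC KC' [f [g [[cf cg hf hg] [f12 g21 gf fg]]]] gl gl'.
  have [h1 h2 h3] := half C C' lam lam' f g KC' cf hf hg f12 gf gl gl'.
  have [k1 k2 k3] := half C' C lam' lam g f KC cg hg hf g21 fg gl' gl.
  exact: (homeomorphic_subsets h1 k1 h2 k2 h3 k3).
move=> phi psi KC' cphi hphi hpsi phiC psiK.
move=> [clam hlam lam0] [clam' hlam' lam'0].
have pos z : C z /\ lam z = 1 -> 0 < lam' (phi z).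
  move=> [Cz lz]; rewrite ltNge; apply/negP => /(lam'0 _ (phiC _ Cz)) e.
  have := psiK z Cz; rewrite e homog_map0 // => ez.
  by move: lz; rewrite -ez homog_fun0 // => /esym/eqP; rewrite oner_eq0.
split=> z Az; have p := pos z Az; have [Cz lz] := Az.
- apply: ptws_continuous => v.
  apply: (@continuousM _ _ (fun y => (lam' (phi y))^-1) (fun y => phi y v)).
    apply: continuousV; first by rewrite gt_eqF.
    by apply: continuous_comp; [exact: cphi|exact: clam'].
  apply: (@continuous_comp _ _ _ phi (fun y : E => y v)); first exact: cphi.
  exact: ptws_coord_continuous.
- split; first by apply: KC'; rewrite ?invr_gt0 //; exact: phiC.
  by rewrite hlam' ?invr_gt0 // mulVf // gt_eqF.
- rewrite hpsi ?invr_gt0 // psiK // hlam ?invr_gt0 // lz mulr1 invrK.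
  by apply/funext => v; rewrite /scalep mulrA mulfV ?mul1r // gt_eqF.
Qed.

Definition supported B z : Prop := forall v, v \notin B -> z v = 0.

Definition orthant B : set E := [set z | supported B z /\ forall v, 0 <= z v].

Definition halfspace B b : set E := [set z | supported B z /\ 0 <= z b].

(** The orthant is the epigraph [t >= - min u] over the vectors [u] with
    [u b = 0], and subtracting [- min u] from the height flattens it. *)
Lemma orthant_halfspace B b : b \in B -> cone_equiv (orthant B) (halfspace B b).
Proof.
move=> bB.
pose flat (y : E) : E := fun v => if v == b then 0 else y v.
exists (fun z v => if v == b then minon B z
                   else if v \in B then z v - z b else 0).
exists (fun y v => if v \in B then flat y v + y b - minon B (flat y) else 0).
have ev := @ptws_coord_continuous R T.
have flatc v : continuous (fun y => flat y v).
  by rewrite /flat; case: (v == b); [exact: cst_continuous|exact (ev v)].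
split; split.
- move=> z; apply: ptws_continuous => v; case: (v == b).
    by apply: minon_continuous => w; exact (ev w).
  case: (v \in B); last exact: cst_continuous.
  by apply: continuousB; [exact (ev v z)|exact (ev b z)].
- move=> y; apply: ptws_continuous => v.
  case: (v \in B); last exact: cst_continuous.
  apply: continuousB; last exact: minon_continuous.
  by apply: continuousD; [exact (flatc v y)|exact (ev b y)].
- move=> c z c0; apply/funext => v; rewrite /scalep minonZ //.
  by case: (v == b) => //; case: (v \in B); rewrite ?mulr0 // mulrBr.
- move=> c z c0; apply/funext => v; rewrite /scalep.
  have e : flat (fun v => c * z v) = (fun v => c * flat z v).
    by apply/funext => w; rewrite /flat; case: (w == b); rewrite ?mulr0.
  by rewrite e minonZ //; case: (v \in B); rewrite ?mulr0 // mulrBr mulrDr.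
- move=> z [zB z0]; split=> [v vB|]; last first.
    by rewrite eqxx; have [w _ ->] := minon_attained z bB.
  case: eqP => [vb|_]; last by rewrite (negbTE vB).
  by rewrite vb bB in vB.
- move=> y [yB y0]; split=> v; first by move/negbTE->.
  case: ifP => // vB; have := minon_le (flat y) vB; lra.
- move=> z [zB z0]; apply/funext => v; case: ifPn => [vB|/zB ->//].
  set y : E := fun w => _.
  have yE w : w \in B -> flat y w = z w - z b.
    by move=> wB; rewrite /flat /y wB; case: eqP => [->|_] //; rewrite subrr.
  by rewrite (minon_shift bB yE) yE // /y eqxx; lra.
- move=> y [yB y0]; apply/funext => v; rewrite bB.
  have flatb : flat y b = 0 by rewrite /flat eqxx.
  case: eqP => [->|/eqP vb].
    rewrite (minon_shift (u := flat y) (c := y b - minon B (flat y)) bB).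
      by lra.
    by move=> w wB; rewrite wB; lra.
  have flatv : flat y v = y v by rewrite /flat (negbTE vb).
  by case: ifPn => [vB|/yB ->//]; rewrite vB flatb flatv; lra.
Qed.

End Cones.

(** * Coordinates *)

Section Coordinates.
Variables (R : realType) (T : finType) (B : {set T}).
Local Notation E := {ptws T -> R}.

Definition to_row (z : E) : 'rV[R]_#|B| := \row_i z (enum_val i).

(** Extension by [0] outside [B]. *)
Definition of_row (w : 'rV[R]_#|B|) : E :=
  fun v => \sum_i w ord0 i *+ (enum_val i == v).

Lemma to_row_continuous : continuous to_row.
Proof.
move=> z; apply: rV_continuous => i.
rewrite (_ : (fun y => _) = (fun y : E => y (enum_val i))).
  exact: ptws_coord_continuous.
by apply/funext => y; rewrite mxE.
Qed.

Lemma of_row_coord_continuous v : continuous (fun w => of_row w v).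
Proof.
apply: sum_continuous => i _ w; case: (_ == v) => /=.
  exact: coord_continuous.
exact: cst_continuous.
Qed.

Lemma of_row_val w i : of_row w (enum_val i) = w ord0 i.
Proof.
rewrite /of_row (bigD1 i) //= eqxx big1 ?addr0 // => j ji.
by rewrite (inj_eq enum_val_inj) (negbTE ji).
Qed.

Lemma of_row_out w v : v \notin B -> of_row w v = 0.
Proof.
move=> vB; rewrite /of_row big1 // => i _; case: eqP => // e.
by move: vB; rewrite -e enum_valP.
Qed.

Lemma of_rowK : cancel of_row to_row.
Proof. by move=> w; apply/rowP => i; rewrite mxE of_row_val. Qed.

Lemma to_rowK (z : E) v : v \in B -> of_row (to_row z) v = z v.
Proof.
by move=> vB; rewrite -(enum_rankK_in vB vB) of_row_val mxE.
Qed.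

Lemma to_row_norm (z : E) :
  euclidean_norm (to_row z) = Num.sqrt (\sum_(v in B) z v ^+ 2).
Proof.
rewrite /euclidean_norm [in RHS]big_enum_val; congr Num.sqrt.
by apply: eq_bigr => i _; rewrite mxE.
Qed.

End Coordinates.

Section Models.
Variables (R : realType) (T : finType).
Local Notation E := {ptws T -> R}.
Implicit Types (z : E) (B : {set T}).

Definition norm2 B z : R := Num.sqrt (\sum_(v in B) z v ^+ 2).

Lemma norm2_continuous B : continuous (norm2 B).
Proof.
move=> z; apply: (@continuous_comp _ _ _ (fun z : E => \sum_(v in B) z v ^+ 2)).
  apply: sum_continuous => v _ x.
  by apply: continuousM; exact: ptws_coord_continuous.
exact: sqrt_continuous.
Qed.

Lemma norm2_homog B : homog_fun (norm2 B).
Proof.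
move=> c z c0; rewrite /norm2 /scalep.
under eq_bigr do rewrite exprMn.
rewrite -mulr_sumr sqrtrM ?sqr_ge0 // sqrtr_sqr gtr0_norm //.
Qed.

Lemma norm2_le0 B z : norm2 B z <= 0 -> forall v, v \in B -> z v = 0.
Proof.
rewrite /norm2 => h v vB.
have e : \sum_(v in B) z v ^+ 2 == 0.
  rewrite eq_le sumr_ge0 ?andbT => [|w _]; last exact: sqr_ge0.
  by rewrite leNgt -sqrtr_gt0 -leNgt.
move: e; rewrite psumr_eq0 => [/allP/(_ v)|w _]; last exact: sqr_ge0.
by rewrite mem_index_enum vB sqrf_eq0 => /(_ isT)/eqP.
Qed.

Lemma subspace_sphere B :
  homeomorphic (set_type [set z | supported B z /\ norm2 B z = 1])
               (set_type (@unit_sphere R #|B|)).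
Proof.
apply: (@homeomorphic_subsets _ _ _ _ (@to_row R T B) (@of_row R T B)).
- by move=> z _; exact: to_row_continuous.
- by move=> w _; apply: ptws_continuous => v; exact: of_row_coord_continuous.
- by move=> z [_ z1]; rewrite /unit_sphere /= to_row_norm.
- move=> w w1; split; first by move=> v; exact: of_row_out.
  by rewrite /norm2 -to_row_norm of_rowK.
- move=> z [zB _]; apply/funext => v; case: (boolP (v \in B)) => [|vB].
    exact: to_rowK.
  by rewrite of_row_out // zB.
- by move=> w _; exact: of_rowK.
Qed.

(** The slice is a hemisphere for the gauge; forgetting the height [z b],
    which the slice equation recovers from the other coordinates, gives the
    ball. *)
Lemma halfspace_ball B b : b \in B ->
  homeomorphic
    (set_type [set z | halfspace B b z /\ z b + norm2 (B :\ b) z = 1])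
    (set_type (@unit_ball R #|B :\ b|)).
Proof.
move=> bB; pose ext (w : 'rV[R]_#|B :\ b|) : E :=
  fun v => if v == b then 1 - euclidean_norm w else of_row w v.
have to_ext w : to_row (B :\ b) (ext w) = w.
  apply/rowP => i; rewrite mxE /ext; case: eqP => [e|_]; last exact: of_row_val.
  by have := enum_valP i; rewrite e !inE eqxx.
apply: (@homeomorphic_subsets _ _ _ _ (@to_row R T (B :\ b)) ext).
- by move=> z _; exact: to_row_continuous.
- move=> w _; apply: ptws_continuous => v; rewrite /ext.
  case: (v == b); last exact: of_row_coord_continuous.
  apply: continuousB; first exact: cst_continuous.
  rewrite /euclidean_norm.
  apply: (@continuous_comp _ _ _
    (fun w : 'rV[R]_#|B :\ b| => \sum_i w ord0 i ^+ 2)).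
    apply: sum_continuous => i _ x; apply: continuousM; exact: coord_continuous.
  exact: sqrt_continuous.
- move=> z [[_ zb] z1]; rewrite /unit_ball /= to_row_norm -/(norm2 _ _); lra.
- move=> w w1; split.
    rewrite /halfspace /= /ext eqxx; split; last by rewrite subr_ge0.
    move=> v vB; case: eqP => [e|_]; first by rewrite e bB in vB.
    by rewrite of_row_out // !inE (negbTE vB) andbF.
  by rewrite /norm2 -to_row_norm to_ext /ext eqxx subrK.
- move=> z [[zB zb] z1]; apply/funext => v; rewrite /ext to_row_norm.
  case: eqP => [->|/eqP vb]; first by move: z1; rewrite /norm2; lra.
  case: (boolP (v \in B)) => vB; first by rewrite to_rowK // !inE vb.
  by rewrite of_row_out ?zB // !inE (negbTE vB) andbF.
- by move=> w _; exact: to_ext.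
Qed.

End Models.

(** * Ideals of isotone maps *)

Section Ideals.
Variables (disp : Order.disp_t) (P : finPOrderType disp) (n : nat).
Variable B : P -> {set 'I_n}.
Implicit Types (f g h : {ffun P -> 'I_n}) (AA : {set {ffun P -> 'I_n}}).

Definition vertices : {set P * 'I_n} := finset [pred v | v.2 \in B v.1].

(** The membership of [poset_Hom], with the sets [A i] indexed by the poset. *)
Definition isotone_hom f : Prop :=
  (forall x y : P, (x <= y)%O -> (f x <= f y)%N) /\ forall x, f x \in B x.

Definition hom_ideal AA : Prop :=
  (forall f, f \in AA -> isotone_hom f) /\
  (forall f g, f \in AA -> isotone_hom g -> map_le g f -> g \in AA).

(** The vertices [(x, a)] below the graph of [f] such that moving the value of
    [f] at [x] down to [a] keeps [f] isotone. *)
Definition low f : {set P * 'I_n} :=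
  finset [pred v | [&& v.2 \in B v.1, (v.2 < f v.1)%N &
                    [forall y, (y < v.1)%O ==> (f y <= v.2)%N]]].

Definition high f : {set P * 'I_n} :=
  finset [pred v | [&& v.2 \in B v.1, v.2 != f v.1 & v \notin low f]].

Lemma low_vertex f v : v \in low f -> v \in vertices.
Proof. by rewrite !inE => /and3P[]. Qed.

Lemma high_vertex f v : v \in high f -> v \in vertices.
Proof. by rewrite !inE => /and3P[]. Qed.

Lemma graph_not_low f x : (x, f x) \in low f = false.
Proof. by rewrite inE /= ltnn andbF. Qed.

Lemma graph_not_high f x : (x, f x) \in high f = false.
Proof. by rewrite inE /= eqxx andbF. Qed.

Lemma high_not_low f v : v \in high f -> (v \in low f) = false.
Proof. by rewrite inE => /and3P[_ _ /negbTE]. Qed.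

(** Any independent choice of values, each equal to [f x] or low for [f], is
    isotone: for [x < y] the value at [x] is at most [f x], which is at most
    the value at [y]. *)
Lemma low_choice AA f g : hom_ideal AA -> f \in AA ->
  (forall x, (x, g x) \in low f \/ g x = f x) -> g \in AA.
Proof.
move=> [homA downA] fA gf; have [fmono fB] := homA f fA.
have gle x : (g x <= f x)%N.
  by case: (gf x) => [|->//]; rewrite inE /= => /and3P[_ /ltnW].
apply: (downA f) => //; split=> [x y|x]; last first.
  by case: (gf x) => [|->//]; rewrite inE /= => /and3P[].
rewrite le_eqVlt => /orP[/eqP-> //|xy]; apply: leq_trans (gle x) _.
case: (gf y) => [|->]; last by apply/fmono/ltW.
by rewrite inE /= => /and3P[_ _ /forallP/(_ x)]; rewrite xy.
Qed.

(** At a minimal point where [g] falls below [f], the value of [g] dominates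
    the values of [f] further down. *)
Lemma low_exists f g : isotone_hom g -> ~ map_le f g ->
  exists x, (x, g x) \in low f.
Proof.
move=> [gmono gB] nfg.
have [x0 x0P] : exists x, (g x < f x)%N.
  apply: contra_notP nfg => nE x; rewrite leqNgt; apply/negP => gf.
  by apply: nE; exists x.
case: (@arg_minnP _ x0 (fun x => (g x < f x)%N)
  (fun x => #|[pred y | (y < x)%O]|) x0P) => x xP xmin.
exists x; rewrite inE /= gB xP /=; apply/forallP => y; apply/implyP => yx.
apply: leq_trans (gmono _ _ (ltW yx)); rewrite leqNgt; apply/negP => /xmin.
rewrite leqNgt => /negP; apply; apply: proper_card; apply/properP; split.
  by apply/fintype.subsetP => z; rewrite !inE => /lt_trans; apply.
by exists y; rewrite !inE ?ltxx.
Qed.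

(** A map with the largest sum of values is maximal. *)
Lemma maximal_exists AA f0 : f0 \in AA ->
  exists2 f, f \in AA & forall g, g \in AA -> map_le f g -> g = f.
Proof.
move=> f0A.
case: (@arg_maxnP _ f0 (mem AA) (fun f => \sum_x f x)%N f0A) => f fA fmax.
exists f => // g gA fg; apply/ffunP => x; apply/eqP; rewrite eq_sym.
have /eqP : (\sum_x f x = \sum_x g x)%N.
  have gef : (\sum_x g x <= \sum_x f x)%N := fmax g gA.
  by apply/eqP; rewrite eqn_leq gef andbT; apply: leq_sum => y _; exact: fg.
have := @leqif_sum _ predT (fun x => f x == g x) (fun x => f x : nat)
  (fun x => g x : nat).
case=> [y _|_ ->]; first by split; [exact: fg|].
by move=> /forallP/(_ x).
Qed.

Lemma hom_idealD1 AA f : hom_ideal AA ->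
  (forall g, g \in AA -> map_le f g -> g = f) -> hom_ideal (AA :\ f).
Proof.
move=> [homA downA] fmax; split=> [g|g h]; rewrite !inE => /andP[gf gA].
  exact: homA.
move=> hh hg; rewrite (downA g) // andbT; apply/eqP => hf.
by move/eqP: gf; apply; apply: fmax; rewrite -?hf.
Qed.

End Ideals.

(** * The cone over the complex of an ideal *)

Section Fan.
Variables (R : realType) (disp : Order.disp_t) (P : finPOrderType disp).
Variables (n : nat) (B : P -> {set 'I_n}).
Local Notation T := (P * 'I_n)%type.
Local Notation E := {ptws T -> R}.
Local Notation V := (vertices B).
Implicit Types (f g h : {ffun P -> 'I_n}) (AA : {set {ffun P -> 'I_n}}) (z : E).

Definition selects z g : Prop :=
  forall x a, a \in B x -> z (x, g x) <= z (x, a).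

(** The value of the chosen map at [x] has to attain the minimum of the row
    [z (x, _)]; this condition ignores the addition of constants to rows. *)
Definition fan AA : set E := [set z | exists2 g, g \in AA & selects z g].

Definition fiber (x : P) : {set T} :=
  finset [pred v | (v.1 == x) && (v.2 \in B x)].

(** The representative with row minima [0], up to constants on the rows. *)
Definition normalize z : E :=
  fun v => if v \in V then z v - minon (fiber v.1) z else 0.

Definition fan_cone AA : set E := [set z | fan AA z /\ normalize z = z].

(** Equality up to constants on the rows, the quotient in which [normalize]
    picks representatives. *)
Definition row_equiv z z' : Prop :=
  exists c : P -> R, forall v, v \in V -> z' v = z v + c v.1.

Lemma normalize_equiv z : row_equiv z (normalize z).
Proof.
by exists (fun x => - minon (fiber x) z) => v vV; rewrite /normalize vV.
Qed.

Lemma eq_normalize z z' : row_equiv z z' -> normalize z' = normalize z.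
Proof.
move=> [c zz']; apply/funext => v; rewrite /normalize; case: ifP => // vV.
have vF : v \in fiber v.1 by move: vV; rewrite !inE eqxx.
rewrite (minon_shift (u := z) (c := c v.1) vF) ?zz' //.
  by lra.
by move=> w; rewrite inE => /andP[/eqP e wB]; rewrite zz' ?e // inE /= e.
Qed.

Lemma normalizeK z : normalize (normalize z) = normalize z.
Proof. exact: (eq_normalize (normalize_equiv z)). Qed.

Lemma fan_equiv AA z z' : (forall f, f \in AA -> isotone_hom B f) ->
  row_equiv z z' -> fan AA z -> fan AA z'.
Proof.
move=> homA [c zz'] [g gA gz]; exists g => // x a aB.
have [_ gB] := homA g gA.
by rewrite !zz' ?inE //= lerD2r; exact: gz.
Qed.

Lemma normalize_continuous : continuous normalize.
Proof.
move=> z; apply: ptws_continuous => v; rewrite /normalize.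
case: (v \in V); last exact: cst_continuous.
apply: continuousB; first exact: ptws_coord_continuous.
by apply: minon_continuous => w; exact (@ptws_coord_continuous R T w).
Qed.

Lemma normalize_homog : homog_map normalize.
Proof.
move=> c z c0; apply/funext => v; rewrite /normalize /scalep minonZ //.
by case: ifP; rewrite ?mulr0 // mulrBr.
Qed.

(** With row minima [0], attaining the minimum means vanishing: these are the
    multiples of the points of the geometric realization. *)
Lemma fan_coneP AA z : (forall f, f \in AA -> isotone_hom B f) ->
  fan_cone AA z <->
  [/\ forall v, 0 <= z v, supported V z &
      exists2 g, g \in AA & forall x, z (x, g x) = 0].
Proof.
move=> homA; split=> [[[g gA gz] nz]|[z0 zV [g gA gz]]].
  have [_ gB] := homA g gA.
  have minE x : minon (fiber x) z = z (x, g x).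
    apply: (@minon_eqP _ _ _ _ (x, g x)) => //; first by rewrite inE /= eqxx gB.
    by move=> [y a]; rewrite inE /= => /andP[/eqP-> aB]; exact: gz.
  have zE v : z v = if v \in V then z v - z (v.1, g v.1) else 0.
    by rewrite -{1}nz /normalize minE.
  split=> [v|v vV|]; last by exists g => // x; rewrite zE inE /= gB subrr.
    rewrite zE; case: ifP => //; rewrite inE subr_ge0.
    by case: v => x a; exact: gz.
  by rewrite zE (negbTE vV).
have [_ gB] := homA g gA.
split; first by exists g => // x a _; rewrite gz.
apply/funext => v; rewrite /normalize; case: ifPn => [vV|/zV -> //].
rewrite (@minon_eqP _ _ _ _ (v.1, g v.1) 0) ?subr0 //.
by rewrite inE /= eqxx gB.
Qed.

Lemma fan_cone_cone AA : (forall f, f \in AA -> isotone_hom B f) ->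
  cone (fan_cone AA).
Proof.
move=> homA c z c0 /(fan_coneP _ homA)[z0 zV [g gA gz]].
apply/(fan_coneP _ homA); rewrite /scalep; split=> [v|v vV|].
- by rewrite mulr_ge0 // ltW.
- by rewrite zV ?mulr0.
- by exists g => // x; rewrite gz mulr0.
Qed.

Lemma fan_cone_set1 h : isotone_hom B h ->
  fan_cone [set h]%SET = orthant (V :\: graph_set h).
Proof.
move=> hh.
have homA f : f \in [set h]%SET -> isotone_hom B f by rewrite inE => /eqP ->.
apply/seteqP; split=> z.
  move=> /(fan_coneP _ homA)[z0 zV [g]]; rewrite inE => /eqP-> hz.
  split=> // -[x a]; rewrite finset.in_setD negb_and negbK => /orP[|/zV //].
  by rewrite inE /= => /eqP ->.
move=> [zV z0]; apply/(fan_coneP _ homA); split=> // [v vV|].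
  by apply: zV; rewrite finset.in_setD (negbTE vV) andbF.
exists h => [|x]; first by rewrite inE.
by apply: zV; rewrite finset.in_setD inE /= eqxx.
Qed.

(** * The shift along a maximal map *)

Definition gap f z (v : T) : R := z v - z (v.1, f v.1).

Definition mu f z : R := minon (low B f) (gap f z).

Definition nu f z : R := minon (high B f) (gap f z).

Definition shift f (s : R) z : E :=
  fun v => if v \in low B f then z v + s
           else if v \in high B f then z v - s else z v.

(** The shift fixes [mu + nu]. Restricted to a line of slope [-1] in the plane
    of [(mu, nu)], with [c = mu + nu], pushing is the identity for
    [mu <= - c] and doubles the distance to [- c] beyond, so when [c > 0] it
    stretches the part [- c <= mu <= 0] over [- c <= mu <= c], whose upper end
    is [nu = 0]; when [c <= 0] it moves nothing that has [mu <= 0]. *)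
Definition push f z : E := shift f (Num.max 0 (2 * mu f z + nu f z)) z.

Definition pull f z : E := shift f (- Num.max 0 (mu f z + nu f z / 2)) z.

Lemma gap_continuous f v : continuous (fun z => gap f z v).
Proof.
by move=> z; apply: continuousB; exact: ptws_coord_continuous.
Qed.

Lemma gap_scale f c z : gap f (scalep c z) = fun v => c * gap f z v.
Proof. by apply/funext => v; rewrite /gap /scalep mulrBr. Qed.

Lemma gap_equiv f z z' v : isotone_hom B f -> row_equiv z z' -> v \in V ->
  gap f z' v = gap f z v.
Proof.
move=> [_ fB] [c zz'] vV; have fV : (v.1, f v.1) \in V by rewrite inE /= fB.
by rewrite /gap !zz' //=; lra.
Qed.

Lemma mu_continuous f : continuous (mu f).
Proof. by apply: minon_continuous => v; exact: gap_continuous. Qed.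

Lemma nu_continuous f : continuous (nu f).
Proof. by apply: minon_continuous => v; exact: gap_continuous. Qed.

Lemma shift_continuous f (s : E -> R) : continuous s ->
  continuous (fun z => shift f (s z) z).
Proof.
move=> cs z; apply: ptws_continuous => v; rewrite /shift.
case: (v \in low B f); last case: (v \in high B f).
- by apply: continuousD; [exact: ptws_coord_continuous|exact: cs].
- by apply: continuousB; [exact: ptws_coord_continuous|exact: cs].
- exact: ptws_coord_continuous.
Qed.

Lemma max0_continuous (s : E -> R) : continuous s ->
  continuous (fun z => Num.max 0 (s z)).
Proof.
move=> cs z; apply: (@continuous_max R E (fun=> 0) s); last exact: cs.
exact: (@cst_continuous E R 0 z).
Qed.

Lemma push_continuous f : continuous (push f).
Proof.
apply: (@shift_continuous f (fun z => Num.max 0 (2 * mu f z + nu f z))).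
apply: (@max0_continuous (fun z => 2 * mu f z + nu f z)) => z.
apply: (@continuousD R R E (fun z => 2 * mu f z) (nu f)).
  apply: (@continuousM R E (fun=> 2) (mu f)); last exact: mu_continuous.
  exact: (@cst_continuous E R 2 z).
exact: nu_continuous.
Qed.

Lemma pull_continuous f : continuous (pull f).
Proof.
apply: (@shift_continuous f (fun z => - Num.max 0 (mu f z + nu f z / 2))) => z.
apply: (@continuousN R R E (fun z => Num.max 0 (mu f z + nu f z / 2))).
apply: (@max0_continuous (fun z => mu f z + nu f z / 2)) => {}z.
apply: (@continuousD R R E (mu f) (fun z => nu f z / 2)).
  exact: mu_continuous.
apply: (@continuousM R E (nu f) (fun=> 2^-1)); first exact: nu_continuous.
exact: (@cst_continuous E R 2^-1 z).
Qed.

Lemma shift_scale f c s z :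
  shift f (c * s) (scalep c z) = scalep c (shift f s z).
Proof.
apply/funext => v; rewrite /shift /scalep.
by case: ifP => _; [rewrite mulrDr|case: ifP => _ //; rewrite mulrBr].
Qed.

Lemma max0_scale (c s : R) : 0 < c -> Num.max 0 (c * s) = c * Num.max 0 s.
Proof. by move=> c0; rewrite maxr_pMr ?mulr0 // ltW. Qed.

Lemma push_homog f : homog_map (push f).
Proof.
move=> c z c0; rewrite /push /mu /nu gap_scale !minonZ //.
by rewrite mulrCA -mulrDr max0_scale // shift_scale.
Qed.

Lemma pull_homog f : homog_map (pull f).
Proof.
move=> c z c0; rewrite /pull /mu /nu gap_scale !minonZ //.
by rewrite -mulrA -mulrDr max0_scale // -mulrN shift_scale.
Qed.

Lemma shift_shift f s t z : shift f s (shift f t z) = shift f (t + s) z.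
Proof.
apply/funext => v; rewrite /shift /=.
case: (v \in low B f); first by rewrite addrA.
by case: (v \in high B f); rewrite ?opprD ?addrA.
Qed.

Lemma shift0 f z : shift f 0 z = z.
Proof.
by apply/funext => v; rewrite /shift addr0 subr0 !if_same.
Qed.

Lemma shift_equiv f s z z' :
  row_equiv z z' -> row_equiv (shift f s z) (shift f s z').
Proof.
move=> [c zz']; exists c => v /zz' e; rewrite /shift e.
by case: (v \in low B f); [lra|case: (v \in high B f); lra].
Qed.

Section Step.
Variables (f : {ffun P -> 'I_n}) (v0 v1 : T).
Hypothesis f_hom : isotone_hom B f.
Hypothesis v0low : v0 \in low B f.
Hypothesis v1high : v1 \in high B f.

Lemma mu_shift s z : mu f (shift f s z) = mu f z + s.
Proof.
apply: (minon_shift v0low) => v vlow.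
by rewrite /gap /shift graph_not_low graph_not_high vlow; lra.
Qed.

Lemma nu_shift s z : nu f (shift f s z) = nu f z - s.
Proof.
apply: (minon_shift v1high) => v vhigh.
rewrite /gap /shift graph_not_low graph_not_high vhigh (high_not_low vhigh).
by lra.
Qed.

Lemma pushK z : pull f (push f z) = z.
Proof.
rewrite /pull /push mu_shift nu_shift shift_shift.
set s := Num.max _ _; rewrite (_ : s + _ = 0) ?shift0 //.
by rewrite /s !maxEle; do 2!case: ifP; lra.
Qed.

Lemma pullK z : push f (pull f z) = z.
Proof.
rewrite /push /pull mu_shift nu_shift shift_shift.
set s := - Num.max _ _; rewrite (_ : s + _ = 0) ?shift0 //.
by rewrite /s !maxEle; do 2!case: ifP; lra.
Qed.

Lemma mu_equiv z z' : row_equiv z z' -> mu f z' = mu f z.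
Proof.
move=> zz'; apply: (eq_minon v0low) => v /low_vertex vV.
exact: gap_equiv.
Qed.

Lemma nu_equiv z z' : row_equiv z z' -> nu f z' = nu f z.
Proof.
move=> zz'; apply: (eq_minon v1high) => v /high_vertex vV.
exact: gap_equiv.
Qed.

Lemma push_equiv z z' : row_equiv z z' -> row_equiv (push f z) (push f z').
Proof.
by move=> zz'; rewrite /push (mu_equiv zz') (nu_equiv zz'); exact: shift_equiv.
Qed.

Lemma pull_equiv z z' : row_equiv z z' -> row_equiv (pull f z) (pull f z').
Proof.
by move=> zz'; rewrite /pull (mu_equiv zz') (nu_equiv zz'); exact: shift_equiv.
Qed.

End Step.

(** Where no high coordinate undercuts [f], minimising over the low values and
    [f x] minimises over the whole row, and the rows can be treated
    independently by [low_choice]. *)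
Lemma high_selection AA f z : hom_ideal B AA -> f \in AA ->
  (forall v, v \in high B f -> 0 <= gap f z v) ->
  exists2 g, selects z g & forall x, (x, g x) \in low B f \/ g x = f x.
Proof.
move=> [homA _] fA zhigh; have [_ fB] := homA f fA.
pose cand x := [pred a | ((x, a) \in low B f) || (a == f x)].
have candf x : cand x (f x) by rewrite /= eqxx orbT.
exists [ffun x => [arg min_(a < f x | cand x a) z (x, a)]%O].
  move=> x a aB; rewrite ffunE; case: arg_minP => // b _ bmin.
  case: (boolP (cand x a)) => [|nc]; first exact: bmin.
  apply: le_trans (bmin _ (candf x)) _.
  move: nc; rewrite /= negb_or => /andP[alow af].
  have := zhigh (x, a); rewrite /gap /= subr_ge0; apply.
  by rewrite inE /= aB af.
move=> x; rewrite ffunE; case: arg_minP => // b /orP[|/eqP]; by [left|right].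
Qed.

Lemma fan_high AA f z : hom_ideal B AA -> f \in AA ->
  (forall v, v \in high B f -> 0 <= gap f z v) -> fan AA z.
Proof.
move=> iA fA /(high_selection iA fA)[g gz gf].
by exists g => //; exact: (low_choice iA fA).
Qed.

(** If the selection is [f] itself, lowering it to a low vertex that does no
    worse gives a selection different from [f]. *)
Lemma fanD1_high AA f z : hom_ideal B AA -> f \in AA ->
  (forall v, v \in high B f -> 0 <= gap f z v) ->
  (exists2 v, v \in low B f & gap f z v <= 0) -> fan (AA :\ f) z.
Proof.
move=> iA fA zhigh [[x0 a0] v0low z0].
have [g gz gf] := high_selection iA fA zhigh.
have gA : g \in AA by exact: (low_choice iA fA).
case: (eqVneq g f) => [e|ngf]; last by exists g => //; rewrite !inE ngf.
pose g' := [ffun x => if x == x0 then a0 else f x].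
exists g'.
  rewrite !inE; apply/andP; split.
    apply/eqP => /ffunP/(_ x0); rewrite ffunE eqxx => e0.
    by move: v0low; rewrite e0 graph_not_low.
  apply: (low_choice iA fA) => x; rewrite ffunE.
  by case: eqP => [->|_]; [left|right].
move=> x a aB; rewrite ffunE.
case: eqP => [e0|_]; last by rewrite -e; exact: gz.
subst x; apply: le_trans (gz _ _ aB); rewrite e.
by move: z0; rewrite /gap subr_le0.
Qed.

(** * Removing a maximal map *)

(** Any other map in the ideal fails to dominate [f], and so attains some row
    minimum at a low vertex. *)
Lemma mu_le0 AA f z : hom_ideal B AA ->
  (forall g, g \in AA -> map_le f g -> g = f) -> isotone_hom B f ->
  fan (AA :\ f) z -> mu f z <= 0.
Proof.
move=> [homA _] fmax [_ fB] [g]; rewrite !inE => /andP[gf gA] gz.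
have [|x xlow] := @low_exists _ _ _ B f g (homA g gA).
  by move=> /(fmax _ gA)/eqP; apply/negP.
apply: le_trans (minon_le _ xlow) _.
by rewrite /gap subr_le0 /=; exact: gz.
Qed.

(** The fan of the ideal without [f] lies in [mu <= 0] and contains every [z]
    with [mu <= 0] and [nu >= 0]; adding [f] adds the rest of [nu >= 0], over
    which [push] stretches that part. *)
Lemma fan_cone_step AA f : hom_ideal B AA -> f \in AA ->
  (forall g, g \in AA -> map_le f g -> g = f) ->
  (exists g, g \in AA :\ f) -> high B f != finset.set0 ->
  cone_equiv (fan_cone (AA :\ f)) (fan_cone AA).
Proof.
move=> iA fA fmax [g0 g0A] /set0Pn[v1 v1high].
have iA' := hom_idealD1 iA fmax.
have f_hom := iA.1 f fA.
have [v0 v0low] : exists v0, v0 \in low B f.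
  move: g0A; rewrite !inE => /andP[gf gA].
  have [|x xlow] := @low_exists _ _ _ B f g0 (iA.1 g0 gA); last first.
    by exists (x, g0 x).
  by move=> /(fmax _ gA)/eqP; apply/negP.
have muS := mu_shift v0low; have nuS := nu_shift v1high.
have muN := mu_le0 iA fmax f_hom.
have nuP z : 0 <= nu f z -> forall v, v \in high B f -> 0 <= gap f z v.
  by move=> nu0 v vh; apply: le_trans nu0 (minon_le _ vh).
have muP z : mu f z <= 0 -> exists2 v, v \in low B f & gap f z v <= 0.
  move=> mu0; have [v vl e] := minon_attained (gap f z) v0low.
  by exists v; rewrite // -e.
have pushF z : fan (AA :\ f) z -> fan AA (push f z).
  move=> zF; have mu0 := muN z zF; rewrite /push maxEle; case: ifP => [s0|_].
    by apply: (fan_high iA fA); apply: nuP; rewrite nuS; lra.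
  by rewrite shift0; case: zF => g; rewrite !inE => /andP[_ gA] gz; exists g.
have pullF z : fan AA z -> fan (AA :\ f) (pull f z).
  move=> [g gA gz]; rewrite /pull maxEle.
  case: (eqVneq g f) => [e|gf]; last first.
    have zF : fan (AA :\ f) z by exists g => //; rewrite !inE gf.
    have mu0 := muN z zF; case: ifP => [s0|_]; last by rewrite oppr0 shift0.
    by apply: (fanD1_high iA fA);
      [apply: nuP; rewrite nuS|apply: muP; rewrite muS]; lra.
  have gap0 v : v \in V -> 0 <= gap f z v.
    by case: v => x a; rewrite inE /gap subr_ge0 -e /=; exact: gz.
  have mu0 : 0 <= mu f z.
    rewrite /mu.
    by have [v /low_vertex/gap0 ? ->] := minon_attained (gap f z) v0low.
  have nu0 : 0 <= nu f z.
    rewrite /nu.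
    by have [v /high_vertex/gap0 ? ->] := minon_attained (gap f z) v1high.
  case: ifP => [s0|/negP]; last by lra.
  by apply: (fanD1_high iA fA);
    [apply: nuP; rewrite nuS|apply: muP; rewrite muS]; lra.
exists (normalize \o push f), (normalize \o pull f); split; split=> /=.
- move=> z; apply: continuous_comp; first exact: push_continuous.
  exact: normalize_continuous.
- move=> z; apply: continuous_comp; first exact: pull_continuous.
  exact: normalize_continuous.
- by move=> c z c0 /=; rewrite push_homog // normalize_homog.
- by move=> c z c0 /=; rewrite pull_homog // normalize_homog.
- move=> z [zF _]; split; last exact: normalizeK.
  exact: fan_equiv iA.1 (normalize_equiv _) (pushF _ zF).
- move=> z [zF _]; split; last exact: normalizeK.
  exact: fan_equiv iA'.1 (normalize_equiv _) (pullF _ zF).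
- move=> z [_ nz].
  have e := pull_equiv f_hom v0low v1high (normalize_equiv (push f z)).
  by rewrite (eq_normalize e) (pushK v0low v1high).
- move=> z [_ nz].
  have e := push_equiv f_hom v0low v1high (normalize_equiv (pull f z)).
  by rewrite (eq_normalize e) (pullK v0low v1high).
Qed.

(** Maximal maps are removed one at a time; the last one standing only asks
    for vanishing on its graph. *)
Lemma fan_cone_orthant AA : hom_ideal B AA -> AA != finset.set0 ->
  (forall f, f \in AA -> high B f != finset.set0) ->
  exists2 h, h \in AA & cone_equiv (orthant (V :\: graph_set h)) (fan_cone AA).
Proof.
have [N] := ubnP #|AA|.
elim: N AA => // N IH AA /ltnSE AN iA /set0Pn[f0 f0A] highA.
have [f fA fmax] := maximal_exists f0A.
case: (eqVneq (AA :\ f) finset.set0) => [A0|An0].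
  have -> : AA = [set f]%SET.
    apply/eqP; rewrite finset.eqEsubset finset.sub1set fA andbT.
    by rewrite -finset.setD_eq0 A0.
  exists f; rewrite ?inE // fan_cone_set1; first exact: cone_equiv_refl.
  exact: iA.1.
have [||//||h] := IH (AA :\ f).
- by move: AN; rewrite (cardsD1 f) fA.
- exact: hom_idealD1.
- by move=> g; rewrite inE => /andP[_ /highA].
rewrite inE => /andP[_ hA] e; exists h => //.
apply: cone_equiv_trans e _; apply: fan_cone_step => //; last exact: highA.
exact/set0Pn.
Qed.

(** Without high vertices every [z] lies in the fan, so only the normalization
    is left, and vanishing on the graph of [f] is another normalization. *)
Lemma fan_cone_full AA f :
  hom_ideal B AA -> f \in AA -> high B f = finset.set0 ->
  cone_equiv (fan_cone AA) [set z | supported (V :\: graph_set f) z].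
Proof.
move=> iA fA high0; have f_hom := iA.1 f fA.
exists (fun z v => if v \in V then gap f z v else 0), normalize.
have equiv z : row_equiv z (fun v => if v \in V then gap f z v else 0).
  by exists (fun x => - z (x, f x)) => v ->.
split; split.
- move=> z; apply: ptws_continuous => v; case: (v \in V).
    exact: gap_continuous.
  exact: cst_continuous.
- exact: normalize_continuous.
- move=> c z c0; apply/funext => v; rewrite gap_scale /scalep.
  by case: ifP; rewrite ?mulr0.
- exact: normalize_homog.
- move=> z _ v; rewrite finset.in_setD negb_and negbK => /orP[|/negbTE-> //].
  case: v => x a ag; have /eqP -> : a == f x by move: ag; rewrite inE.
  by rewrite /gap subrr if_same.
- move=> z _; split; last exact: normalizeK.
  by apply: (fan_high iA fA) => v; rewrite high0 inE.
- by move=> z [_ nz]; rewrite (eq_normalize (equiv z)).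
- move=> z zs; apply/funext => v; case: ifPn => [vV|vV].
    rewrite (gap_equiv f_hom (normalize_equiv z) vV) /gap.
    by rewrite [X in _ - X]zs ?subr0 // finset.in_setD inE /= eqxx.
  by rewrite zs // finset.in_setD (negbTE vV) andbF.
Qed.

(** * Gauges and the realization *)

Lemma fan_cone_gauge AA : (forall f, f \in AA -> isotone_hom B f) ->
  gauge_on (fan_cone AA) (fun z : E => \sum_v z v).
Proof.
move=> homA; split.
- by apply: sum_continuous => v _; exact (@ptws_coord_continuous R T v).
- by move=> c z c0; rewrite mulr_sumr.
- move=> z /(fan_coneP _ homA)[z0 _ _] s0; apply/funext => v.
  have /eqP : \sum_v z v = 0 by apply/le_anti; rewrite s0 sumr_ge0.
  rewrite psumr_eq0 // => /allP/(_ v).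
  by rewrite mem_index_enum => /(_ isT)/eqP.
Qed.

End Fan.

Lemma subspace_gauge (R : realType) (T : finType) (D : {set T}) :
  gauge_on [set z : {ptws T -> R} | supported D z] (norm2 D).
Proof.
split; [exact: norm2_continuous|exact: norm2_homog|].
move=> z zs /norm2_le0 z0; apply/funext => v.
by case: (boolP (v \in D)) => [/z0|/zs].
Qed.

Lemma halfspace_gauge (R : realType) (T : finType) (D : {set T}) b :
  gauge_on (halfspace D b) (fun z : {ptws T -> R} => z b + norm2 (D :\ b) z).
Proof.
split.
- move=> z; apply: continuousD; last exact: norm2_continuous.
  exact: ptws_coord_continuous.
- by move=> c z c0; rewrite norm2_homog // mulrDr.
- move=> z [zs zb] s0; have N0 : 0 <= norm2 (D :\ b) z by exact: sqrtr_ge0.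
  have zN : norm2 (D :\ b) z <= 0 by lra.
  apply/funext => v; case: (eqVneq v b) => [->|vb]; first by lra.
  case: (boolP (v \in D)) => [vD|/zs //].
  by apply: (norm2_le0 zN); rewrite !inE vb.
Qed.

Theorem proposition6p1 (R : realType) (k : fieldType)
  (d : Order.disp_t) (P : finPOrderType d) (m n : nat)
  (p : 'I_m -> P) (A : 'I_m -> {set 'I_n}) (AA : set {ffun P -> 'I_n}) :
  (0 < n)%N ->
  bijective p ->
  (forall i j : 'I_m, (p i < p j)%O -> (i < j)%N) ->
  (forall i : 'I_m, exists a : 'I_n, a \in A i) ->
  poset_ideal (@map_le P n) (poset_Hom p A) AA ->
  simplicial_ball R (Delta k p A AA) \/ simplicial_sphere R (Delta k p A AA).
Proof.
move=> _ [q pK qK] _ _ [[f0 f0A] AAhom AAdown].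
pose B x := A (q x).
have homE f : poset_Hom p A f <-> isotone_hom B f.
  split=> -[fmono fA]; split=> //.
    by move=> x; have := fA (q x); rewrite qK.
  by move=> i; have := fA (p i); rewrite /B pK.
pose AF : {set {ffun P -> 'I_n}} := finset [pred f | `[< AA f >]].
have AFE f : (f \in AF) = `[< AA f >] by rewrite inE.
have iA : hom_ideal B AF.
  split=> [f|f g]; rewrite !AFE; first by move=> /asboolP/AAhom/homE.
  by move=> /asboolP fA gh gf; apply/asboolP; apply: AAdown fA _ gf; apply/homE.
have f0AF : f0 \in AF by rewrite AFE; apply/asboolP.
have VE : vertex_set p A = vertices B.
  apply/setP => -[x a]; rewrite !inE /=; apply/existsP/idP => [[i]|aB].
    by move=> /existsP[b /andP[bA /eqP[-> ->]]]; rewrite /B pK.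
  by exists (q x); apply/existsP; exists a; rewrite qK eqxx andbT.
have realE : @geometric_realization R _ (Delta k p A AA) =
    [set z | fan_cone B AF z /\ \sum_v z v = 1].
  apply/seteqP; split=> z.
    move=> [z0 z1 /DeltaP[zV [f fA fz]]]; split=> //.
    apply/(fan_coneP _ iA.1); split=> // [v|].
      rewrite -VE => vV; apply/eqP; apply: contraR vV => zv.
      by apply: (fintype.subsetP zV); rewrite inE.
    exists f => [|x]; first by rewrite AFE; apply/asboolP.
    have := fintype.subsetP fz (x, f x); rewrite !inE /= eqxx => /(_ isT).
    by rewrite negbK => /eqP.
  move=> [/(fan_coneP _ iA.1)[z0 zV [f]]]; rewrite AFE => /asboolP fA fz z1.
  split=> //; apply/DeltaP; split.
    apply/fintype.subsetP => v; rewrite VE inE /=; apply: contraNT => /zV ->.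
    exact: eqxx.
  exists f => //; apply/fintype.subsetP => -[x a]; rewrite !inE /= => /eqP ->.
  by rewrite fz eqxx.
have complexD : simplicial_complex (Delta k p A AA).
  split=> [|F G FG /DeltaP[GV [f fA fG]]].
    apply/DeltaP; split; first exact: finset.sub0set.
    by exists f0 => //; rewrite finset.setC0 finset.subsetT.
  apply/DeltaP; split; first exact: fintype.subset_trans FG GV.
  by exists f => //; apply: fintype.subset_trans fG _; rewrite finset.setCS.
have KA := fan_cone_cone (R := R) iA.1; have gA := fan_cone_gauge R iA.1.
have [/existsP[f /andP[fA /eqP high0]]|nhigh] :=
    boolP [exists f, (f \in AF) && (high B f == finset.set0)].
  right; split=> //; exists #|vertices B :\: graph_set f|; rewrite realE.
  apply: homeomorphic_trans (subspace_sphere R _).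
  apply: (slice_homeomorphic KA _ (fan_cone_full R iA fA high0) gA
    (@subspace_gauge R _ _)).
  by move=> c z c0 zs v /zs e; rewrite /scalep e mulr0.
have highA f : f \in AF -> high B f != finset.set0.
  by move=> fA; apply: contra nhigh => h0; apply/existsP; exists f; rewrite fA.
have An0 : AF != finset.set0 by apply/set0Pn; exists f0.
have [h hA e] := fan_cone_orthant R iA An0 highA.
(* A high vertex of [h] provides the coordinate that becomes the height. *)
have /set0Pn[b] := highA h hA; rewrite inE => /and3P[bB bh _].
have bD : b \in vertices B :\: graph_set h by rewrite !inE bB bh.
left; split=> //; exists #|(vertices B :\: graph_set h) :\ b|; rewrite realE.
apply: homeomorphic_trans (halfspace_ball R bD).
have e' := cone_equiv_trans (cone_equiv_sym e) (orthant_halfspace R bD).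
apply: (slice_homeomorphic KA _ e' gA (@halfspace_gauge R _ _ _)).
move=> c z c0 [zs zb]; split; last by rewrite /scalep mulr_ge0 // ltW.
by move=> v /zs zv; rewrite /scalep zv mulr0.
Qed.
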